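(* Let $\mathcal{C}$ be a Markov category. Then any two coinflip structures on $\mathcal{C}$ are equal.
   Context: A Markov category is a symmetric monoidal category $(\mathcal{C},\otimes,I)$ in which every object $X$ is equipped with a commutative comonoid structure $(\mathrm{copy}_X: X\to X\otimes X,\ \mathrm{del}_X : X\to I)$ with $\mathrm{del}_{X\otimes Y}=\mathrm{del}_X\otimes \mathrm{del}_Y$ and $\mathrm{copy}_{X\otimes Y}=(X\otimes \sigma_{X,Y}\otimes Y)(\mathrm{copy}_X\otimes \mathrm{copy}_Y)$ ($\sigma$ the symmetry), and with $\mathrm{del}$ natural. Structural isomorphisms are suppressed. A midpoint algebra (in sets) is a set $A$ with $m:A\times A\to A$ satisfying $m(a,a)=a$, $m(a,b)=m(b,a)$, $m(m(a,b),m(c,d))=m(m(a,c),m(b,d))$; a midpoint homomorphism is a map $f$ with $m(f(a),f(a'))=f(m(a,a'))$. A coinflip structure on $\mathcal{C}$ is a midpoint algebra structure on each hom-set $\mathcal{C}(X,Y)$ such that all pre- and postcomposition maps are midpoint homomorphisms. *)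

(* Defs.v *)
Set Implicit Arguments.
Unset Strict Implicit.

Declare Scope cat_scope.
Delimit Scope cat_scope with cat.
Open Scope cat_scope.

(* Hom-sets are types compared with Leibniz equality. *)
Record Category := {
  Ob :> Type;
  Hom : Ob -> Ob -> Type;
  idm : forall X, Hom X X;
  comp : forall X Y Z, Hom Y Z -> Hom X Y -> Hom X Z;
  comp_idl : forall X Y (f : Hom X Y), comp (idm Y) f = f;
  comp_idr : forall X Y (f : Hom X Y), comp f (idm X) = f;
  comp_assoc : forall W X Y Z (h : Hom Y Z) (g : Hom X Y) (f : Hom W X),
    comp h (comp g f) = comp (comp h g) f
}.

Arguments idm {c} X.
Arguments comp {c X Y Z} g f.

Notation "g ∘ f" := (comp g f) (at level 40, left associativity) : cat_scope.

Record Iso (C : Category) (X Y : C) := {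
  fwd :> Hom X Y;
  inv : Hom Y X;
  fwd_inv : fwd ∘ inv = idm Y;
  inv_fwd : inv ∘ fwd = idm X
}.

Record MonoidalCategory := {
  mon_cat :> Category;
  tens : mon_cat -> mon_cat -> mon_cat;
  tensm : forall X X' Y Y' : mon_cat,
    Hom X X' -> Hom Y Y' -> Hom (tens X Y) (tens X' Y');
  munit : mon_cat;
  assoc : forall X Y Z, Iso (tens (tens X Y) Z) (tens X (tens Y Z));
  lunit : forall X, Iso (tens munit X) X;
  runit : forall X, Iso (tens X munit) X;
  tensm_id : forall X Y, tensm (idm X) (idm Y) = idm (tens X Y);
  tensm_comp : forall (X X' X'' Y Y' Y'' : mon_cat)
    (f' : Hom X' X'') (f : Hom X X') (g' : Hom Y' Y'') (g : Hom Y Y'),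
    tensm (f' ∘ f) (g' ∘ g) = tensm f' g' ∘ tensm f g;
  assoc_nat : forall (X X' Y Y' Z Z' : mon_cat)
    (f : Hom X X') (g : Hom Y Y') (h : Hom Z Z'),
    assoc X' Y' Z' ∘ tensm (tensm f g) h
      = tensm f (tensm g h) ∘ assoc X Y Z;
  lunit_nat : forall (X X' : mon_cat) (f : Hom X X'),
    lunit X' ∘ tensm (idm munit) f = f ∘ lunit X;
  runit_nat : forall (X X' : mon_cat) (f : Hom X X'),
    runit X' ∘ tensm f (idm munit) = f ∘ runit X;
  pentagon : forall W X Y Z,
    assoc W X (tens Y Z) ∘ assoc (tens W X) Y Z
      = tensm (idm W) (assoc X Y Z) ∘ assoc W (tens X Y) Z
          ∘ tensm (assoc W X Y) (idm Z);
  triangle : forall X Y,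
    tensm (idm X) (lunit Y) ∘ assoc X munit Y = tensm (runit X) (idm Y)
}.

Arguments tens {m} X Y.
Arguments tensm {m X X' Y Y'} f g.
Arguments munit {m}.
Arguments assoc {m} X Y Z.
Arguments lunit {m} X.
Arguments runit {m} X.

Notation "X ⊗ Y" := (tens X Y) (at level 35, right associativity) : cat_scope.
Notation "f ⊠ g" := (tensm f g) (at level 35, right associativity) : cat_scope.

Record SymmetricMonoidalCategory := {
  smc_mon :> MonoidalCategory;
  swap : forall X Y : smc_mon, Hom (X ⊗ Y) (Y ⊗ X);
  swap_nat : forall (X X' Y Y' : smc_mon) (f : Hom X X') (g : Hom Y Y'),
    swap X' Y' ∘ (f ⊠ g) = (g ⊠ f) ∘ swap X Y;
  swap_swap : forall X Y, swap Y X ∘ swap X Y = idm (X ⊗ Y);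
  hexagon : forall X Y Z,
    assoc Y Z X ∘ swap X (Y ⊗ Z) ∘ assoc X Y Z
      = (idm Y ⊠ swap X Z) ∘ assoc Y X Z ∘ (swap X Y ⊠ idm Z)
}.

Arguments swap {s} X Y.

(* The map written [X ⊗ swap X Y ⊗ Y] when associators are suppressed. *)
Definition middle_swap (C : SymmetricMonoidalCategory) (X Y : C) :
    Hom ((X ⊗ X) ⊗ (Y ⊗ Y)) ((X ⊗ Y) ⊗ (X ⊗ Y)) :=
  inv (assoc X Y (X ⊗ Y))
    ∘ (idm X ⊠ assoc Y X Y)
    ∘ (idm X ⊠ (swap X Y ⊠ idm Y))
    ∘ (idm X ⊠ inv (assoc X Y Y))
    ∘ assoc X X (Y ⊗ Y).

Record CommutativeComonoid (C : SymmetricMonoidalCategory) (X : C) := {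
  comult : Hom X (X ⊗ X);
  counit : Hom X munit;
  comult_assoc :
    assoc X X X ∘ (comult ⊠ idm X) ∘ comult = (idm X ⊠ comult) ∘ comult;
  counit_l : lunit X ∘ (counit ⊠ idm X) ∘ comult = idm X;
  counit_r : runit X ∘ (idm X ⊠ counit) ∘ comult = idm X;
  comult_comm : swap X X ∘ comult = comult
}.

Record MarkovCategory := {
  markov_smc :> SymmetricMonoidalCategory;
  comonoid : forall X : markov_smc, CommutativeComonoid X;
  copy := fun X => comult (comonoid X);
  del := fun X => counit (comonoid X);
  del_tens : forall X Y,
    del (X ⊗ Y) = lunit munit ∘ (del X ⊠ del Y);
  copy_tens : forall X Y,
    copy (X ⊗ Y) = middle_swap X Y ∘ (copy X ⊠ copy Y);
  del_nat : forall (X Y : markov_smc) (f : Hom X Y), del Y ∘ f = del X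
}.

Record MidpointAlgebra (A : Type) := {
  mid :> A -> A -> A;
  mid_idem : forall a, mid a a = a;
  mid_comm : forall a b, mid a b = mid b a;
  mid_medial : forall a b c d,
    mid (mid a b) (mid c d) = mid (mid a c) (mid b d)
}.

Definition midpoint_hom (A B : Type) (mA : MidpointAlgebra A)
    (mB : MidpointAlgebra B) (f : A -> B) : Prop :=
  forall a a', mB (f a) (f a') = f (mA a a').

Record CoinflipStructure (C : Category) := {
  coinflip :> forall X Y : C, MidpointAlgebra (Hom X Y);
  precomp_hom : forall (X Y Z : C) (f : Hom X Y),
    midpoint_hom (coinflip Y Z) (coinflip X Z) (fun g => g ∘ f);
  postcomp_hom : forall (X Y Z : C) (g : Hom Y Z),
    midpoint_hom (coinflip X Y) (coinflip X Z) (fun f => g ∘ f)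
}.

(* Main.v *)
Require Import Defs.
From Stdlib Require Import FunctionalExtensionality ProofIrrelevance.

(** Uniqueness is an Eckmann-Hilton argument.  Composition is a midpoint
    homomorphism in each variable, for either structure.  Hence expanding a
    composite [m(p, q) ∘ m'(h, k)] in the two possible orders yields an
    interchange law between [m] and [m'] ([coinflip_interchange]), restricted to
    matrices of morphisms whose entries are composites [p ∘ h], [p ∘ k], [q ∘ h],
    [q ∘ k].  Since [m] and [m'] have no common unit, the usual Eckmann-Hilton
    matrix is replaced by the symmetric one with rows [(f, g)] and [(g, f)]: by
    commutativity and idempotence the interchange law for it reads
    [m f g = m' f g].  The Markov structure makes this matrix a matrix of
    composites: take [h] and [k] to be the pairings of [(f, g)] and of [(g, f)],
    and [p] and [q] the two projections.  A pairing in a Markov category has the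
    expected marginals ([proj_l_pair], [proj_r_pair]) although it need not be
    determined by them. *)

(** Two different structures may be used on the two factors, which is where
    their interaction comes from. *)
Lemma coinflip_interchange {C : Category} (m m' : CoinflipStructure C)
    {X Y Z : C} (p q : Hom Y Z) (h k : Hom X Y) :
  m X Z (m' X Z (p ∘ h) (p ∘ k)) (m' X Z (q ∘ h) (q ∘ k))
  = m' X Z (m X Z (p ∘ h) (q ∘ h)) (m X Z (p ∘ k) (q ∘ k)).
Proof.
  rewrite (postcomp_hom m' p h k), (postcomp_hom m' q h k).
  rewrite (precomp_hom m h p q), (precomp_hom m k p q).
  rewrite (postcomp_hom m' (m Y Z p q) h k).
  exact (precomp_hom m (m' X Y h k) p q).
Qed.

Definition pair {C : MarkovCategory} {X Y Z : C} (f : Hom X Y) (g : Hom X Z) : Hom X (Y ⊗ Z) :=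
  (f ⊠ g) ∘ copy X.

Definition proj_l {C : MarkovCategory} (Y Z : C) : Hom (Y ⊗ Z) Y := runit Y ∘ (idm Y ⊠ del Z).

Definition proj_r {C : MarkovCategory} (Y Z : C) : Hom (Y ⊗ Z) Z := lunit Z ∘ (del Y ⊠ idm Z).

(** Naturality of [del] turns discarding the output of [g] into discarding its
    input, and the counit law of the copy then removes that input. *)
Lemma proj_l_pair {C : MarkovCategory} {X Y Z : C} (f : Hom X Y) (g : Hom X Z) :
  proj_l Y Z ∘ pair f g = f.
Proof.
  unfold proj_l, pair.
  rewrite comp_assoc, <- (comp_assoc (runit Y)), <- tensm_comp.
  rewrite del_nat, comp_idl.
  assert (f ⊠ del X = (f ⊠ idm munit) ∘ (idm X ⊠ del X)) as ->
    by (rewrite <- tensm_comp, comp_idr, comp_idl; reflexivity).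
  rewrite (comp_assoc (runit Y)), runit_nat, <- !(comp_assoc f).
  unfold copy, del. rewrite counit_r. apply comp_idr.
Qed.

Lemma proj_r_pair {C : MarkovCategory} {X Y Z : C} (f : Hom X Y) (g : Hom X Z) :
  proj_r Y Z ∘ pair f g = g.
Proof.
  unfold proj_r, pair.
  rewrite comp_assoc, <- (comp_assoc (lunit Z)), <- tensm_comp.
  rewrite del_nat, comp_idl.
  assert (del X ⊠ g = (idm munit ⊠ g) ∘ (del X ⊠ idm X)) as ->
    by (rewrite <- tensm_comp, comp_idr, comp_idl; reflexivity).
  rewrite (comp_assoc (lunit Z)), lunit_nat, <- !(comp_assoc g).
  unfold copy, del. rewrite counit_l. apply comp_idr.
Qed.

Lemma coinflip_mid_unique (C : MarkovCategory) (m m' : CoinflipStructure C) (X Y : C)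
    (f g : Hom X Y) : m X Y f g = m' X Y f g.
Proof.
  pose proof (coinflip_interchange m m' (proj_l Y Y) (proj_r Y Y)
                (pair f g) (pair g f)) as E.
  rewrite !proj_l_pair, !proj_r_pair in E.
  rewrite (mid_comm (m' X Y) g f), (mid_comm (m X Y) g f) in E.
  rewrite !mid_idem in E.
  symmetry. exact E.
Qed.

Lemma midpoint_algebra_ext (A : Type) (a b : MidpointAlgebra A) :
  (forall x y, a x y = b x y) -> a = b.
Proof.
  destruct a as [s i c d], b as [t i' c' d']; simpl; intros E.
  assert (s = t) as -> by (extensionality x; extensionality y; apply E).
  f_equal; apply proof_irrelevance.
Qed.

Lemma coinflip_structure_ext (C : Category) (m m' : CoinflipStructure C) :
  (forall X Y f g, m X Y f g = m' X Y f g) -> m = m'.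
Proof.
  destruct m as [s i c], m' as [t i' c']; simpl; intros E.
  assert (s = t) as ->.
  { extensionality X; extensionality Y.
    apply midpoint_algebra_ext, E. }
  f_equal; apply proof_irrelevance.
Qed.

Theorem proposition4p4 :
  forall (C : MarkovCategory) (m m' : CoinflipStructure C), m = m'.
Proof.
  intros C m m'.
  apply coinflip_structure_ext, coinflip_mid_unique.
Qed.
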